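(* Let $\alpha\in[0,\infty)$. Let $L$ be the event that $\mathscr{G}(n,\alpha/n)$ contains no cycles and, for $r>0$, let $B_r$ be the event that $\mathscr{G}(n,\alpha/n)$ has no connected component with more than $r$ vertices. Then \[ \lim_{r\to\infty}\liminf_{n\to\infty}P_{n,\alpha}(B_r)^{1/n}=\lim_{\epsilon\downarrow0}\limsup_{n\to\infty}P_{n,\alpha}(B_{\epsilon n})^{1/n}=\lim_{n\to\infty}P_{n,\alpha}(L)^{1/n}, \] all limits existing.
   Context: $\mathscr{G}(n,p)$ is the random graph on vertex set $\{1,\dots,n\}$ in which each of the $\binom n2$ unordered pairs is an edge independently with probability $p$; here $p=\alpha/n$, and $P_{n,\alpha}$ is the corresponding probability measure. *)

(* Defs.v *)
From HB Require Import structures.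
From mathcomp Require Import all_boot all_order all_algebra.
From mathcomp Require Import all_classical all_reals all_analysis.
Set Implicit Arguments. Unset Strict Implicit. Unset Printing Implicit Defensive.
Import Order.TTheory GRing.Theory Num.Theory.
Local Open Scope ring_scope.

(* A simple graph on vertex set 'I_n (= {1..n} relabelled {0..n-1}) is
   represented by its edge set: a set of ordered pairs (i,j) with i < j,
   each unordered pair {i,j} being encoded once. *)
Definition pairs (n : nat) : {set 'I_n * 'I_n} :=
  [set e : 'I_n * 'I_n | (e.1 < e.2)%N].

Definition adj (n : nat) (E : {set 'I_n * 'I_n}) : rel 'I_n :=
  fun x y => ((x, y) \in E) || ((y, x) \in E).

Definition Pgnp (R : realType) (n : nat) (p : R)
    (A : pred {set 'I_n * 'I_n}) : R :=
  \sum_(E : {set 'I_n * 'I_n} | (E \subset pairs n) && A E)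
     p ^+ #|E| * (1 - p) ^+ (#|pairs n| - #|E|).

Definition P_alpha (R : realType) (n : nat) (alpha : R) (A : pred {set 'I_n * 'I_n}) : R :=
  @Pgnp R n (alpha / n%:R) A.

Definition has_cycle (n : nat) (E : {set 'I_n * 'I_n}) : bool :=
  [exists k : 'I_n.+1, [exists t : k.-tuple 'I_n,
     [&& (2 < k)%N, uniq t & path.cycle (adj E) t]]].

Definition eventL (n : nat) : pred {set 'I_n * 'I_n} :=
  fun E => ~~ has_cycle E.

Definition eventB (R : realType) (n : nat) (r : R) : pred {set 'I_n * 'I_n} :=
  fun E => [forall v : 'I_n, (#|[set u | connect (adj E) v u]|%:R <= r)].

Arguments Pgnp {R} n p A.
Arguments P_alpha {R} n alpha A.
Arguments eventB {R} n r.

(* Main.v *)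
Require Import Defs.
From HB Require Import structures.
From mathcomp Require Import all_boot all_order all_algebra.
From mathcomp Require Import all_classical all_reals all_analysis.
From mathcomp Require Import zify ring lra.
(* Restores the finite-set lemma names shadowed by classical_sets. *)
Import boot.path boot.fintype boot.fingraph boot.finset.
Import Order.TTheory GRing.Theory Num.Theory.
Import numFieldNormedType.Exports.
Set Implicit Arguments.
Unset Strict Implicit.
Unset Printing Implicit Defensive.
Local Open Scope ring_scope.

(** With [q = p / (1 - p)], the probability of an event [A] is
    [(1 - p)^N Z(A)], where [Z(A)] is the sum of [q^|E|] over [E] in [A].

    - Every graph is a spanning forest plus edges inside its components, and a
      graph in [B_(eps n)] has at most [eps n^2] pairs inside components. Hence
      [Z(B_(eps n)) <= (1 + q)^(eps n^2) Z(L)], a factor [exp (O(eps) n)].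
    - Every forest has a set [S] of at most [n / (r + 1)] vertices whose deletion
      leaves components of size at most [r]. Summing over [S] and over the edges
      meeting [S] gives [Z(L) <= exp (o_r(1) n) Z(B_r)].
    - It remains to see that [P(L)^(1/n)] converges. A forest [F] on [n] vertices
      has [t^(n - |F|)] colourings by [t] colours that are constant on components,
      so [n^n] times the sum of [(alpha / n)^|F|] over forests [F] counts the
      coloured forests with [n] colours, weighted by [alpha^|F|]. Splitting
      [n + m] colours into [n] and [m] and keeping the colourings that use the
      first [n] colours on exactly [n] vertices shows that this number divided by
      [n!] is supermultiplicative, and Fekete's lemma applies. The case
      [alpha = 0] is the convergence of [(n^n / n!)^(1/n)]. *)

(** * Forests, spanning forests and separators *)

Section Graphs.
Variable n : nat.
Implicit Types (E F G : {set 'I_n * 'I_n}) (x y u v w : 'I_n) (A S T : {set 'I_n}).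

Lemma adj_sym E : symmetric (adj E).
Proof. by move=> x y; rewrite /adj orbC. Qed.

Lemma connect_adj_sym E : connect_sym (adj E).
Proof. exact: sym_connect_sym (adj_sym E). Qed.

Lemma sub_adj E F : E \subset F -> subrel (adj E) (adj F).
Proof. by move=> /subsetP sEF x y /orP[] /sEF h; rewrite /adj h ?orbT. Qed.

Lemma sub_connect_adj E F :
  E \subset F -> subrel (connect (adj E)) (connect (adj F)).
Proof.
by move=> sEF; apply: connect_sub => x y /(sub_adj sEF) h; apply: connect1.
Qed.

Lemma connect_invariant (V : finType) (C : eqType) (e : rel V) (c : V -> C) :
  (forall x y : V, e x y -> c x = c y) -> forall x y : V, connect e x y -> c x = c y.
Proof.
move=> ce x y /connectP[p]; elim: p x => [|z p IH] x /=; first by move=> _ ->.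
by case/andP=> /ce -> /IH.
Qed.

(* For [F \subset pairs n] this is acyclicity, see [eventL_bridges]. *)
Definition bridges F := [forall e in F, ~~ connect (adj (F :\ e)) e.1 e.2].

Lemma bridgesP F :
  reflect (forall x y, (x, y) \in F -> ~~ connect (adj (F :\ (x, y))) x y)
          (bridges F).
Proof.
apply: (iffP forall_inP) => h; first by move=> x y /h.
by case=> x y /h.
Qed.

Lemma bridgesS E F : E \subset F -> bridges F -> bridges E.
Proof.
move=> sEF /bridgesP bF; apply/bridgesP => x y xyE.
apply: contra (bF _ _ (subsetP sEF _ xyE)).
exact/sub_connect_adj/setSD.
Qed.

Lemma connect_adjD1 F x y : connect (adj (F :\ (x, y))) x y ->
  connect (adj F) =2 connect (adj (F :\ (x, y))).
Proof.
move=> cxy u v; apply/idP/idP; last exact/sub_connect_adj/subsetDl.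
apply: connect_sub => {u v} u v; rewrite {1}/adj.
have sub a b : (a, b) \in F -> connect (adj (F :\ (x, y))) a b.
  have [[-> ->] //|ne abF] := (a, b) =P (x, y).
  by apply: connect1; rewrite /adj !inE abF; case: eqP.
by case/orP => /sub //; rewrite connect_adj_sym.
Qed.

(** An edge that is not a bridge can be deleted without changing connectivity; deleting such edges
    one by one ends in a forest. *)
Lemma spanning_forest E :
  exists2 F, bridges F & F \subset E /\ connect (adj F) =2 connect (adj E).
Proof.
have [k] := ubnP #|E|; elim: k E => // k IH E ltEk.
have [bE|] := boolP (bridges E); first by exists E.
rewrite negb_forall_in => /exists_inP[[x y] xyE] /=; rewrite negbK => cxy.
have [|F bF [sF cF]] := IH (E :\ (x, y)).
  by move: ltEk; rewrite (cardsD1 (x, y)) xyE.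
exists F => //; split; first exact: subset_trans sF (subsetDl _ _).
by move=> u v; rewrite cF (connect_adjD1 cxy).
Qed.

(** The rest of a cycle through [x] and [y] joins the ends of the edge between them, which is then
    not a bridge. *)
Lemma bridges_acyclic F : bridges F -> ~~ has_cycle F.
Proof.
move=> /bridgesP bF; apply/negP => /existsP[k /existsP[t /and3P[]]].
case: t => t /= /eqP <- {k}; case: t => [|x [|y p]] // sz.
rewrite [uniq _]/= [path.cycle _ _]/= inE negb_or => /and3P[/andP[nexy nxp] nyp up].
rewrite rcons_path => /and3P[axy pyp alx].
(* A cycle has at least three vertices, so its closing edge at [x] differs from the edge between [x]
   and [y]. *)
have pne : last y p != y.
  case: p sz nyp {nxp up pyp alx} => //= z p _ nyp.
  by apply: contraNneq nyp => <-; apply: mem_last.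
pose e := if (x, y) \in F then (x, y) else (y, x).
have eF : e \in F by move: axy; rewrite /e /adj; case: ifP.
have ne a b : adj F a b -> (a, b) != (x, y) -> (a, b) != (y, x) -> adj (F :\ e) a b.
  move=> aab n1 n2; rewrite /adj /e; case: ifP => _;
  rewrite !inE; move: n1 n2; rewrite !xpair_eqE ![(b == _) && _]andbC => -> ->;
  exact: aab.
have cyx : connect (adj (F :\ e)) y x.
  apply: (@connect_trans _ _ (last y p)).
    apply/connectP; exists p => //.
    apply: (sub_in_path (P := mem (y :: p)) _ _ pyp); last exact/allP.
    move=> a b ain bin aab; apply: ne => //; rewrite xpair_eqE.
      by apply: contraTN ain => /andP[/eqP-> _]; rewrite inE negb_or nexy.
    by apply: contraTN bin => /andP[_ /eqP->]; rewrite inE negb_or nexy.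
  apply: connect1; apply: ne => //; rewrite xpair_eqE.
    by rewrite (negPf nexy) andbF.
  by rewrite (negPf pne).
move: eF (bF e.1 e.2); rewrite -surjective_pairing => eF /(_ eF).
by move: cyx; rewrite /e; case: ifP => _ /= cyx; rewrite ?cyx // connect_adj_sym cyx.
Qed.

Lemma acyclic_bridges F : F \subset pairs n -> ~~ has_cycle F -> bridges F.
Proof.
move=> sF; apply: contraNT; rewrite negb_forall_in => /exists_inP[[x y] xyF] /=.
rewrite negbK => /connectP[p0 pp0]; case/shortenP: pp0 => p pp up _ yE.
have ltxy : (x < y)%N by have := subsetP sF _ xyF; rewrite inE.
(* A path of length 0 contradicts [x < y]; one of length 1 would be the reversed pair [(y, x)],
   which is not in [pairs n]. A longer path closes to a cycle. *)
case: p pp up yE => [|z [|z' p]] pp up yE.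
- by rewrite yE /= ltnn in ltxy.
- move: pp; rewrite /= in yE; rewrite -yE /= /adj !inE eqxx /= andbT => /andP[_ yxF].
  by have := subsetP sF _ yxF; rewrite inE /= ltnNge (ltnW ltxy).
have sz : (size [:: x, z, z' & p] < n.+1)%N.
  by rewrite ltnS -[n in (_ <= n)%N]card_ord -(card_uniqP up) max_card.
apply/existsP; exists (Ordinal sz); apply/existsP.
exists (in_tuple [:: x, z, z' & p]); apply/and3P; split => //.
rewrite (cycle_path x) /= -/(last z' p).
have -> : last z' p = y by rewrite yE.
rewrite {1}/adj xyF orbT /=.
by move: pp => /(sub_path (sub_adj (subsetDl _ _))).
Qed.

Lemma eventL_bridges F : F \subset pairs n -> eventL F = bridges F.
Proof.
move=> sF; apply/idP/idP; [exact: acyclic_bridges|exact: bridges_acyclic].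
Qed.

(** * Small separators of forests *)

Definition adj_in E A : rel 'I_n := fun x y => [&& adj E x y, x \in A & y \in A].

Lemma adj_in_sym E A : symmetric (adj_in E A).
Proof. by move=> x y; rewrite /adj_in adj_sym; congr (_ && _); rewrite andbC. Qed.

Lemma connect_adj_in E A x y : connect (adj_in E A) x y -> y != x -> (x \in A) && (y \in A).
Proof.
move=> /connectP[p]; case: p => [_ ->|z p /=]; first by rewrite eqxx.
rewrite {1}/adj_in => /andP[/and3P[_ xA zA]] pp yE _; rewrite xA /=.
by elim: p z zA pp yE => [|w p IH] z zA /=; [move=> _ ->|case/andP=> /and3P[_ _ wA]; exact: IH].
Qed.

Definition component (e : rel 'I_n) x := [set y | connect e x y].

(** Vertices outside [A] are isolated for [adj_in E A]; their components of size 1 are why [A] is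
    assumed nonempty. *)
Lemma card_comp_adj_in E A x :
  (0 < #|A|)%N -> (#|component (adj_in E A) x| <= #|A|)%N.
Proof.
move=> A0; have [xA|xA] := boolP (x \in A).
  apply/subset_leq_card/subsetP => y; rewrite inE => /connect_adj_in.
  by case: (y =P x) => [->//|_ /(_ isT)/andP[]].
apply: leq_trans A0; rewrite -(cards1 x); apply/subset_leq_card/subsetP => y.
rewrite !inE => /connect_adj_in; case: (y =P x) => // _ /(_ isT).
by rewrite (negPf xA).
Qed.

(* [v] is the only vertex of [T] with a neighbour in [A :\: T]. *)
Definition guards F A v T :=
  [&& v \in T, T \subset A &
    [forall x in T :\ v, forall y in A :\: T, ~~ adj F x y]].

(* Two neighbours of [v] joined outside [v] would close a cycle through [v]. *)
Lemma bridges_unique_neighbour F A v u u' : bridges F -> v \notin A ->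
  adj F v u -> adj F v u' -> connect (adj_in F A) u u' -> u = u'.
Proof.
move=> /bridgesP bF vA avu avu' cuu'; apply/eqP/negPn/negP => neu.
pose e := if (v, u) \in F then (v, u) else (u, v).
have eF : e \in F by move: avu; rewrite /e /adj; case: ifP.
have nuv : u != v.
  have : u' != u by rewrite eq_sym.
  by move=> /(connect_adj_in cuu')/andP[uA _]; apply: contraNneq vA => <-.
have nu'v : u' != v.
  have : u' != u by rewrite eq_sym.
  by move=> /(connect_adj_in cuu')/andP[_ uA]; apply: contraNneq vA => <-.
have cuv : connect (adj (F :\ e)) u v.
  apply: (@connect_trans _ _ u').
    apply: connect_sub cuu' => a b /and3P[aab aA bA]; apply: connect1.
    have av : a != v by apply: contraNneq vA => <-.
    have bv : b != v by apply: contraNneq vA => <-.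
    move: aab; rewrite /adj /e; case: ifP => _; rewrite !inE !xpair_eqE;
    by rewrite (negPf av) (negPf bv) ?andbF.
  apply: connect1; move: avu'; rewrite adj_sym /adj /e; case: ifP => _;
  rewrite !inE !xpair_eqE (negPf nu'v) [u' == u]eq_sym (negPf neu) ?andbF /=;
  by rewrite ?[v == u]eq_sym ?(negPf nuv) ?andbF.
move: eF (bF e.1 e.2); rewrite -surjective_pairing => eF /(_ eF).
by move: cuv; rewrite /e; case: ifP => _ /= cuv; rewrite ?cuv // connect_adj_sym cuv.
Qed.

(** Take [T] of least size among the guarded subsets of [A] with more than [r] vertices. A component
    of [T :\ v] with more than [r] vertices would again be guarded by one vertex, and it is smaller
    than [T]. *)
Lemma guarded_separator F A r : bridges F -> (r < #|A|)%N ->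
  exists v T, [/\ guards F A v T, (r < #|T|)%N &
    forall x, x \in T :\ v -> (#|component (adj_in F (T :\ v)) x| <= r)%N].
Proof.
move=> bF ltrA.
pose P (c : 'I_n * {set 'I_n}) := guards F A c.1 c.2 && (r < #|c.2|)%N.
have [v0 v0A] : exists v0, v0 \in A by apply/card_gt0P; apply: leq_ltn_trans ltrA.
(* The set [A] itself is guarded, by any of its vertices. *)
have P0 : P (v0, A).
  rewrite /P ltrA andbT /guards /= v0A subxx /=.
  by apply/forall_inP => x _; apply/forall_inP => y; rewrite setDv inE.
case: (arg_minnP (fun c : 'I_n * {set 'I_n} => #|c.2|) P0) => [[v T]] /=.
rewrite /P /= => /andP[gT ltrT] minT; exists v, T; split=> // x xT.
rewrite leqNgt; apply/negP => ltrC; set C := component _ _ in ltrC.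
have /and3P[vT sTA /forall_inP noT] := gT.
have sCT : C \subset T :\ v.
  apply/subsetP => y; rewrite inE => /connect_adj_in.
  by case: (y =P x) => [->//|_ /(_ isT)/andP[]].
have ltCT : (#|C| < #|T|)%N.
  by rewrite (leq_ltn_trans (subset_leq_card sCT)) // [in ltnRHS](cardsD1 v) vT.
suff [u gC] : exists u, guards F A u C.
  by move: (minT (u, C)); rewrite /= gC ltrC leqNgt ltCT => /(_ isT).
have sCA : C \subset A by rewrite (subset_trans sCT) // (subset_trans (subsetDl _ _)).
(* An edge cannot leave the component [C] inside [T :\ v], and the guard forbids leaving [T]; so
   every edge from [C] to the rest of [A] ends in [v]. *)
have esc a b : a \in C -> b \in A :\: C -> adj F a b -> b = v.
  move=> aC; rewrite inE => /andP[bC bA] aab; apply/eqP/negPn/negP => bv.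
  have aT := subsetP sCT _ aC.
  have [bT|bT] := boolP (b \in T).
    case/negP: bC; move: aC; rewrite !inE => /connect_trans; apply.
    by apply: connect1; rewrite /adj_in aab aT !inE bv bT.
  by move: (noT a aT) => /forall_inP/(_ b); rewrite inE bT bA aab => /(_ isT).
(* The new guard is the neighbour of [v] in [C], unique in a forest. If there is none, no edge
   leaves [C] within [A], and any vertex of [C] will do. *)
have [/existsP[u /andP[uC avu]]|/existsPn none] := boolP [exists u, (u \in C) && adj F v u].
  exists u; rewrite /guards uC sCA /=; apply/forall_inP => a; rewrite inE in_set1 => /andP[au aC].
  apply/forall_inP => b bAC; apply/negP => aab; have bv := esc a b aC bAC aab.
  move: aab; rewrite bv adj_sym => ava; case/eqP: au.
  apply: (bridges_unique_neighbour bF _ ava avu (A := T :\ v)).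
    by rewrite !inE eqxx.
  move: aC uC; rewrite !inE => cxa; apply: connect_trans.
  by rewrite (sym_connect_sym (adj_in_sym _ _)).
exists x; rewrite /guards sCA inE connect0 /=; apply/forall_inP => a /setD1P[ax aC].
apply/forall_inP => b bAC; apply/negP => aab; have bv := esc a b aC bAC aab.
by move: (none a); rewrite aC adj_sym -bv aab.
Qed.

(** Induction on [#|A|]: split off a guarded set [T] as above and put its guard into [S]. Each
    vertex of [S] is paid for by more than [r] vertices of [T]; [0 < r] covers the isolated vertices
    outside [A :\: S]. *)
Lemma separator_in F r A : bridges F -> (0 < r)%N ->
  exists S, [/\ S \subset A, (#|S| * r.+1 <= #|A|)%N &
    forall x, (#|component (adj_in F (A :\: S)) x| <= r)%N].
Proof.
move=> bF r0; have [k] := ubnP #|A|; elim: k A => // k IH A ltAk.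
have [leAr|ltrA] := leqP #|A| r.
  exists finset.set0; split; rewrite ?sub0set ?cards0 ?mul0n // => x; rewrite setD0.
  have [/eqP|A0] := posnP #|A|; last exact: leq_trans (card_comp_adj_in _ _ A0) leAr.
  rewrite cards_eq0 => /eqP ->; apply: leq_trans r0; rewrite -(cards1 x).
  apply/subset_leq_card/subsetP => y; rewrite !inE => /connect_adj_in.
  by case: (y =P x) => // _ /(_ isT); rewrite inE.
have [v [T [/and3P[vT sTA /forall_inP noT] ltrT compT]]] := guarded_separator bF ltrA.
have cAT : #|A| = (#|T| + #|A :\: T|)%N by rewrite -(cardsID T A) (setIidPr sTA).
have [|S [sS cS compS]] := IH (A :\: T); first by lia.
have vS : v \notin S by apply: contraL vT => /(subsetP sS); rewrite inE => /andP[].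
exists (v |: S); split.
- by rewrite subUset sub1set (subsetP sTA) //= (subset_trans sS) ?subsetDl.
- by rewrite cardsU1 vS; lia.
move=> x.
(* Without [v], no edge runs between [T] and [A :\: T], so a component stays on one side. *)
have inv a b : adj_in F (A :\: (v |: S)) a b -> (a \in T) = (b \in T).
  move=> /and3P[aab]; rewrite !inE !negb_or.
  move=> /andP[/andP[av aS] aA] /andP[/andP[bv bS] bA].
  apply/idP/idP => h; apply/negPn/negP => h'.
    move: (noT a); rewrite !inE av h => /(_ isT)/forall_inP/(_ b).
    by rewrite inE h' bA aab => /(_ isT).
  move: (noT b); rewrite !inE bv h => /(_ isT)/forall_inP/(_ a).
  by rewrite inE h' aA adj_sym aab => /(_ isT).
(* A component inside an invariant set [B] can be computed in the graph restricted to [B]; this is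
   used for [T] and for its complement. *)
have sub (B : {set 'I_n}) :
  (forall a b, a \in B -> adj_in F (A :\: (v |: S)) a b -> b \in B) -> x \in B ->
  component (adj_in F (A :\: (v |: S))) x \subset component (adj_in F (B :&: A :\: (v |: S))) x.
  move=> hB xB; apply/subsetP => y; rewrite !inE => /connectP[p pp ->] {y}.
  elim: p x xB pp => [|z p IHp] w wB /=; first by rewrite connect0.
  move=> /andP[awz pp]; have zB := hB _ _ wB awz; apply: connect_trans (IHp _ zB pp).
  apply: connect1; case/and3P: awz => awz wi zi; rewrite /adj_in awz /=.
  by move: wi zi; rewrite !in_setD !in_setI wB zB => /andP[-> ->] /andP[-> ->].
have [xT|xT] := boolP (x \in T).
  have [xv|xv] := boolP (x == v).
    apply: leq_trans r0; rewrite -(cards1 x); apply/subset_leq_card/subsetP => y.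
    rewrite !inE => /connect_adj_in; case: (y =P x) => // _ /(_ isT).
    by rewrite !inE xv.
  apply: leq_trans (compT x _); last by rewrite !inE xv.
  apply/subset_leq_card; apply: subset_trans (sub T _ xT) _.
    by move=> a b aT /inv <-.
  apply/subsetP => y; rewrite !inE; apply: connect_sub => a b /and3P[aab].
  rewrite !inE !negb_or => /andP[/andP[av _] /andP[aT _]] /andP[/andP[bv _] /andP[bT _]].
  by apply: connect1; rewrite /adj_in aab !inE av aT bv bT.
apply: leq_trans (compS x); apply/subset_leq_card.
apply: subset_trans (sub (~: T) _ _) _.
- by move=> a b; rewrite !inE => aT /inv <-.
- by rewrite inE.
apply/subsetP => y; rewrite !inE; apply: connect_sub => a b /and3P[aab].
rewrite !inE !negb_or => /andP[/andP[_ aS] /andP[aT aA]] /andP[/andP[_ bS] /andP[bT bA]].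
by apply: connect1; rewrite /adj_in aab !inE aS aT aA bS bT bA.
Qed.

Definition touching S := [set e : 'I_n * 'I_n | (e.1 \in S) || (e.2 \in S)].

Lemma card_touching S : (#|touching S| <= 2 * (#|S| * n))%N.
Proof.
have -> : touching S = setX S setT :|: setX setT S.
  by apply/setP => -[x y]; rewrite !inE /= andbT.
apply: leq_trans (leq_card_setU _ _) _.
by rewrite !cardsX !cardsT !card_ord mul2n -addnn leq_add2l mulnC.
Qed.

Lemma forest_separator F r : bridges F -> (0 < r)%N ->
  exists2 S : {set 'I_n}, (#|S| * r.+1 <= n)%N &
    forall x, (#|component (adj (F :\: touching S)) x| <= r)%N.
Proof.
move=> bF r0; have [S [_ cS hS]] := separator_in setT bF r0.
exists S; first by move: cS; rewrite cardsT card_ord.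
move=> x; apply: leq_trans (hS x); apply/subset_leq_card/subsetP => y; rewrite !inE.
apply: connect_sub => a b; rewrite /adj !inE !negb_or /= => h.
apply: connect1; rewrite /adj_in /adj !inE !andbT.
by case/orP: h => /andP[/andP[-> ->] ->]; rewrite ?orbT.
Qed.

End Graphs.

(** * Colourings of forests *)

Section Colourings.
Variables (n : nat) (C : finType).
Implicit Types (F : {set 'I_n * 'I_n}) (K : 'I_n -> {set C}) (f : {ffun 'I_n -> C}).

(** These are the opposite of proper colourings. The lists [K v], in place of one common colour set,
    make it possible to prescribe which vertices use which part of [C]. *)
Definition colourings F K : {set {ffun 'I_n -> C}} :=
  [set f : {ffun 'I_n -> C} | [forall v, f v \in K v] && [forall e in F, f e.1 == f e.2]].

Lemma colouringsP F K f :
  reflect ((forall v, f v \in K v) /\ (forall x y, (x, y) \in F -> f x = f y))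
          (f \in colourings F K).
Proof.
rewrite inE; apply: (iffP andP) => -[fK fF]; split.
- exact/forallP.
- by move=> x y /(forall_inP fF)/eqP.
- exact/forallP.
- by apply/forall_inP => -[x y] /fF /= ->.
Qed.

Lemma colouring_connect F K f x y :
  f \in colourings F K -> connect (adj F) x y -> f x = f y.
Proof.
move=> /colouringsP[_ fF]; apply: connect_invariant => a b.
by case/orP => /fF.
Qed.

Definition recolour F x (f : {ffun 'I_n -> C}) (c : C) : {ffun 'I_n -> C} :=
  [ffun v => if connect (adj F) x v then c else f v].

Lemma recolour_colourings F K x f c :
  (forall u v, (u, v) \in F -> K u = K v) -> f \in colourings F K -> c \in K x ->
  recolour F x f c \in colourings F K.
Proof.
move=> KF /colouringsP[fK fF] cK; apply/colouringsP; split=> [v|u v uvF].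
  rewrite ffunE; case: ifP => // xv; suff <- : K x = K v by [].
  by apply: connect_invariant xv => a b /orP[] /KF.
rewrite !ffunE (fF _ _ uvF).
have uv : adj F u v by rewrite /adj uvF.
by rewrite (same_connect_r (@connect_adj_sym _ F) (connect1 uv)).
Qed.

(* Deleting a bridge multiplies the number of colourings by the number of
   colours of its component. *)
Lemma card_colourings F K :
  bridges F -> (forall x y, (x, y) \in F -> K x = K y) ->
  (#|colourings F K| * \prod_(e in F) #|K e.1| = \prod_v #|K v|)%N.
Proof.
have [k] := ubnP #|F|; elim: k F => // k IH F ltFk bF KF.
have [->|[[x y] xyF]] := set_0Vmem F.
  rewrite big_set0 muln1 -[RHS]/(\prod_v #|[pred c | c \in K v]|)%N.
  have -> : #|colourings finset.set0 K| = #|family (fun v => [pred c | c \in K v])|.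
    apply: eq_card => f; apply/colouringsP/familyP => [[]//|h]; split=> //.
    by move=> a b; rewrite inE.
  by rewrite card_family foldrE big_map enumT.
pose F' := F :\ (x, y).
have sF : F' \subset F by apply: subsetDl.
have KF' a b : (a, b) \in F' -> K a = K b by move=> /(subsetP sF); apply: KF.
have nxy : ~~ connect (adj F') x y by move/bridgesP: bF => /(_ _ _ xyF).
have /IH : (#|F'| < k)%N by move: ltFk; rewrite (cardsD1 (x, y)) xyF.
move=> /(_ (bridgesS sF bF) KF') <-.
rewrite (big_setD1 (x, y)) //= mulnA; congr (_ * _)%N.
(* A colouring [g] of [F] and a colour [c] correspond to the colouring of [F'] that gives [c] to the
   whole component of [x] in [F'] and agrees with [g] elsewhere. *)
rewrite -cardsX -(card_in_imset (f := fun fc => recolour F' x fc.1 fc.2)).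
  apply: eq_card => f; apply/imsetP/idP => [[[g c]]|fc].
    rewrite inE => /andP[/= /colouringsP[gK gF] cK] ->.
    apply: recolour_colourings => //.
    by apply/colouringsP; split=> // a b /(subsetP sF) /gF.
  have /colouringsP[fK fF] := fc.
  (* The inverse: copy the colour of [y] to the side of [x], so that the edge is respected again,
     and remember the old colour of [x]. *)
  exists (recolour F' x f (f y), f x) => /=.
    rewrite in_setX /= fK andbT.
    have : recolour F' x f (f y) \in colourings F' K.
      by apply: recolour_colourings => //; rewrite (KF _ _ xyF).
    move=> /colouringsP[rK rF]; apply/colouringsP; split=> // a b.
    have [[-> ->] _|nab abF] := (a, b) =P (x, y).
      by rewrite !ffunE connect0 (negPf nxy).
    by apply: rF; rewrite !inE abF andbT; apply/eqP.
  apply/ffunP => v; rewrite !ffunE; have [xv|//] := boolP (connect _ x v).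
  by rewrite (colouring_connect fc xv).
move=> [g c] [g' c']; rewrite !in_setX /= => /andP[gc cK] /andP[gc' cK'] eqr.
have eqv v := congr1 (fun f : {ffun 'I_n -> C} => f v) eqr.
have ec : c = c' by have := eqv x; rewrite !ffunE connect0.
rewrite -ec; congr pair; apply/ffunP => v.
(* Recolouring erases [g] on the component of [x] in [F']; there [g] takes its value at [y], which
   is left untouched. *)
have := eqv v; rewrite !ffunE; case: ifP => // xv _.
have := eqv y; rewrite !ffunE (negPf nxy) => eqy.
have xy : connect (adj F) x y by apply: connect1; rewrite /adj xyF.
have xv' := sub_connect_adj sF xv.
rewrite -(colouring_connect gc xv') -(colouring_connect gc' xv').
by rewrite (colouring_connect gc xy) (colouring_connect gc' xy).
Qed.

End Colourings.

(** Counting colourings with two colours shows that [2 ^ #|F|] divides [2 ^ n]. *)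
Lemma card_bridges n (F : {set 'I_n * 'I_n}) : bridges F -> (#|F| <= n)%N.
Proof.
move=> bF.
have := card_colourings (C := bool) (K := fun _ => [set: bool]) bF (fun _ _ _ => erefl).
rewrite !prod_nat_const cardsT card_bool card_ord => eq2.
rewrite -(leq_exp2l _ _ (isT : 1 < 2)%N) -eq2 leq_pmull //.
by move: (expn_gt0 2 n); rewrite -eq2 muln_gt0 => /andP[].
Qed.

(** * Order-preserving embeddings and disjoint unions of forests *)

Section Embedding.
Variables (n N : nat) (g : 'I_n -> 'I_N).
Hypothesis ltg : {homo g : x y / (x < y)%N}.

Definition embed (F : {set 'I_n * 'I_n}) : {set 'I_N * 'I_N} :=
  [set (g e.1, g e.2) | e in F].

Lemma ltg_inj : injective g.
Proof.
move=> x y gxy; apply/val_inj; case: (ltngtP x y) => // /ltg.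
  by rewrite gxy ltnn.
by rewrite gxy ltnn.
Qed.

Lemma embed_pair_inj : injective (fun e : 'I_n * 'I_n => (g e.1, g e.2)).
Proof. by move=> [a b] [c d] /= [/ltg_inj -> /ltg_inj ->]. Qed.

Lemma mem_embed F x y : ((g x, g y) \in embed F) = ((x, y) \in F).
Proof. exact: (mem_imset _ (x, y) embed_pair_inj). Qed.

Lemma embed_pairs (F : {set 'I_n * 'I_n}) : F \subset pairs n -> embed F \subset pairs N.
Proof.
move=> /subsetP sF; apply/subsetP => e /imsetP[[x y] /sF].
by rewrite inE => xy ->; rewrite inE /=; apply: ltg.
Qed.

Lemma card_embed F : #|embed F| = #|F|.
Proof. exact/card_imset/embed_pair_inj. Qed.

Lemma connect_embed F (E : {set 'I_N * 'I_N}) :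
  (forall a b, adj E (g a) b -> exists2 a', b = g a' & adj F a a') ->
  forall a b, connect (adj E) (g a) (g b) -> connect (adj F) a b.
Proof.
move=> EF a b /connectP[p]; elim: p a => [|c p IH] a /=.
  by move=> _ /ltg_inj ->.
case/andP => /EF[a' -> aa'] pp lb.
exact: connect_trans (connect1 aa') (IH _ pp lb).
Qed.

End Embedding.

Section DisjointUnion.
Variables (n m N : nat) (g : 'I_n -> 'I_N) (h : 'I_m -> 'I_N).
Hypothesis ltg : {homo g : x y / (x < y)%N}.
Hypothesis gh : forall x y, g x != h y.
Implicit Types (F : {set 'I_n * 'I_n}) (G : {set 'I_m * 'I_m}).

Lemma disjoint_embed F G : [disjoint embed g F & embed h G].
Proof.
rewrite -setI_eq0 -subset0; apply/subsetP => e; rewrite inE => /andP[].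
case/imsetP=> x _ -> /imsetP[y _ [/eqP]].
by rewrite (negPf (gh _ _)).
Qed.

(** No edge of the union leaves the image of [g], so a path from [g x] to [g y] avoiding their edge
    pulls back to [F], against the bridge property there. *)
Lemma bridges_union_l F G x y : bridges F -> (x, y) \in F ->
  ~~ connect (adj ((embed g F :|: embed h G) :\ (g x, g y))) (g x) (g y).
Proof.
move=> /bridgesP bF xyF; apply: contra (bF _ _ xyF).
apply: connect_embed => // a b.
have key a' b' : (a', b') \in (embed g F :|: embed h G) :\ (g x, g y) ->
   (exists2 c, a' = g c & exists2 d, b' = g d & (c, d) \in F :\ (x, y)) \/
   (exists2 c, a' = h c & exists d, b' = h d).
  rewrite in_setD1 in_setU => /andP[ne /orP[]] /imsetP[[c d] cdF [ea eb]].
    left; exists c => //; exists d => //; rewrite !inE cdF andbT.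
    by apply: contraNneq ne => -[cx dy]; rewrite ea eb cx dy.
  by right; exists c => //; exists d.
case/orP => /key[].
- case=> c /(ltg_inj ltg) <- [d -> ad]; exists d => //; by rewrite /adj ad.
- by case=> c /eqP; rewrite (negPf (gh _ _)).
- case=> c -> [d /(ltg_inj ltg) <- ad]; exists c => //; by rewrite /adj ad orbT.
- by case=> c _ [d /eqP]; rewrite (negPf (gh _ _)).
Qed.

End DisjointUnion.

Lemma bridges_union n m N (g : 'I_n -> 'I_N) (h : 'I_m -> 'I_N)
    (F : {set 'I_n * 'I_n}) (G : {set 'I_m * 'I_m}) :
  {homo g : x y / (x < y)%N} -> {homo h : x y / (x < y)%N} ->
  (forall x y, g x != h y) ->
  bridges F -> bridges G -> bridges (embed g F :|: embed h G).
Proof.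
move=> ltg lth gh bF bG; apply/bridgesP => x y; rewrite in_setU => /orP[].
  by case/imsetP=> -[a b] abF [-> ->]; apply: bridges_union_l.
case/imsetP=> -[a b] abF [-> ->]; rewrite setUC; apply: bridges_union_l => //.
by move=> c d; rewrite eq_sym.
Qed.

(** The enumeration is increasing so that embedded edges still obey the convention of [pairs]. *)
Lemma monotone_enumeration N (A : {set 'I_N}) n : #|A| = n ->
  exists2 g : 'I_n -> 'I_N, {homo g : x y / (x < y)%N} & forall x, g x \in A.
Proof.
move=> <-; exists (fun i : 'I_#|A| => enum_val i); last by move=> x; exact: enum_valP.
move=> x y xy; rewrite /enum_val.
have srt : sorted (fun a b : 'I_N => (a < b)%N) (enum A).
  rewrite /enum_mem; apply: sorted_filter; first by move=> a b c; apply: ltn_trans.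
  by have := iota_ltn_sorted 0 N; rewrite -val_enum_ord sorted_map enumT.
rewrite (set_nth_default (enum_default y)); last by rewrite -cardE.
apply: (sorted_ltn_nth (leT := fun a b : 'I_N => (a < b)%N)) => //.
- by move=> a b c; apply: ltn_trans.
- by rewrite inE -cardE.
- by rewrite inE -cardE.
Qed.

(** * Weighted sums over graphs *)

(** When [q] is the odds of an edge, this is the probability of [A] up to a factor independent of
    [A]. *)
Definition gsum (R : realType) (n : nat) (q : R) (A : pred {set 'I_n * 'I_n}) : R :=
  \sum_(E : {set 'I_n * 'I_n} | (E \subset pairs n) && A E) q ^+ #|E|.
Arguments gsum {R} n q A.

Lemma gsum_ge0 (R : realType) n (q : R) A : 0 <= q -> 0 <= gsum n q A.
Proof. by move=> q0; apply: sumr_ge0 => E _; rewrite exprn_ge0. Qed.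

(** A forest [F] has [#|C| ^ (n - #|F|)] colourings; the powers of [#|C|] on the left turn into this
    count. *)
Lemma forest_sum_colourings (R : realType) n (C : finType) (alpha : R) :
  (0 < #|C|)%N ->
  #|C|%:R ^+ n * gsum n (alpha / #|C|%:R) (@bridges n) =
  \sum_(F : {set 'I_n * 'I_n} | (F \subset pairs n) && bridges F)
     alpha ^+ #|F| * #|colourings F (fun _ => [set: C])|%:R.
Proof.
move=> C0; rewrite big_distrr /=; apply: eq_bigr => F /andP[_ bF].
have := card_colourings (C := C) (K := fun _ => [set: C]) bF (fun _ _ _ => erefl).
rewrite !prod_nat_const cardsT card_ord => /(congr1 (fun k => k%:R : R)).
rewrite natrM !natrX => <-; rewrite expr_div_n.
have : #|C|%:R ^+ #|F| != 0 :> R by rewrite expf_neq0 // pnatr_eq0 -lt0n.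
by move=> ?; field.
Qed.

(** Writing the [n + m] colours as a sum type makes the two palettes disjoint by construction. *)
Definition palette n m N (A : {set 'I_N}) (v : 'I_N) : {set 'I_n + 'I_m} :=
  [set c : 'I_n + 'I_m | (if c is inl _ then true else false) == (v \in A)].
Arguments palette : clear implicits.

Lemma card_palette n m N (A : {set 'I_N}) v :
  #|palette n m N A v| = if v \in A then n else m.
Proof.
have [vA|vA] := boolP (v \in A).
  transitivity #|[set (inl x : 'I_n + 'I_m) | x : 'I_n]|.
    apply: eq_card => -[x|x]; rewrite !inE vA /=; symmetry; first exact: imset_f.
    by apply/imsetP => -[].
  by rewrite card_imset ?cardT ?size_enum_ord // => x y [].
transitivity #|[set (inr x : 'I_n + 'I_m) | x : 'I_m]|.
  apply: eq_card => -[x|x]; rewrite !inE (negPf vA) /=; symmetry; last exact: imset_f.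
  by apply/imsetP => -[].
by rewrite card_imset ?cardT ?size_enum_ord // => x y [].
Qed.

(** A colouring determines [A] as the set of vertices with a left colour, so the families for
    different [A] are disjoint. *)
Lemma sum_colourings_palette n m N (F : {set 'I_N * 'I_N}) :
  (\sum_(A : {set 'I_N}) #|colourings F (palette n m N A)| <=
   #|colourings F (fun _ => [set: 'I_n + 'I_m])|)%N.
Proof.
pose col (f : {ffun 'I_N -> 'I_n + 'I_m}) := [set v | if f v is inl _ then true else false].
rewrite -[leqRHS]sum1_card (partition_big col predT) //=.
apply: leq_sum => A _; rewrite sum1_card; apply/subset_leq_card/subsetP => f.
move=> /colouringsP[fK fF]; rewrite unfold_in; apply/andP; split.
  by apply/colouringsP; split => // v; rewrite inE.
by apply/eqP/setP => v; have := fK v; rewrite !inE => /eqP.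
Qed.

(** A forest on [A] and one on its complement, transported from ['I_n] and ['I_m], combine into a
    forest without edges between the two sides. Edge weights multiply, and so do the numbers of
    colourings. *)
Lemma forest_sum_split (R : realType) n m (alpha : R) (A : {set 'I_(n + m)}) :
  0 <= alpha -> (0 < n)%N -> (0 < m)%N -> #|A| = n ->
  (n%:R ^+ n * gsum n (alpha / n%:R) (@bridges n)) *
  (m%:R ^+ m * gsum m (alpha / m%:R) (@bridges m)) <=
  \sum_(F : {set 'I_(n + m) * 'I_(n + m)} | (F \subset pairs (n + m)) && bridges F)
     alpha ^+ #|F| * #|colourings F (palette n m (n + m) A)|%:R.
Proof.
move=> alpha0 n0 m0 cA.
have cAC : #|~: A| = m by rewrite cardsCs setCK card_ord cA addKn.
have [g ltg gA] := monotone_enumeration cA.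
have [h lth hA] := monotone_enumeration cAC.
have {}hA x : h x \notin A by have := hA x; rewrite inE.
have gh x y : g x != h y by apply: contraNneq (hA y) => <-.
pose phi (FG : {set 'I_n * 'I_n} * {set 'I_m * 'I_m}) := embed g FG.1 :|: embed h FG.2.
have phi_inj : injective phi.
  move=> [F G] [F' G'] eqphi; congr pair; apply/setP => -[x y].
    have := congr1 (fun E : {set _} => (g x, g y) \in E) eqphi.
    rewrite !in_setU /= !(mem_embed ltg).
    have no H : ((g x, g y) \in embed h H) = false.
      by apply/imsetP => -[e _ [/eqP]]; rewrite (negPf (gh _ _)).
    by rewrite !no !orbF.
  have := congr1 (fun E : {set _} => (h x, h y) \in E) eqphi.
  rewrite !in_setU /= !(mem_embed lth).
  have no H : ((h x, h y) \in embed g H) = false.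
    by apply/imsetP => -[e _ [/eqP]]; rewrite eq_sym (negPf (gh _ _)).
  by rewrite !no.
pose ok n (F : {set 'I_n * 'I_n}) := (F \subset pairs n) && bridges F.
have -> : (n%:R ^+ n * gsum n (alpha / n%:R) (@bridges n)) *
  (m%:R ^+ m * gsum m (alpha / m%:R) (@bridges m)) =
  \sum_(FG | ok n FG.1 && ok m FG.2)
     alpha ^+ #|phi FG| * #|colourings (phi FG) (palette n m (n + m) A)|%:R.
  rewrite /gsum mulr_sumr [X in _ * X]mulr_sumr big_distrlr /= pair_big /=.
  apply: eq_bigr => -[F G] /= /andP[/andP[_ bF] /andP[_ bG]].
  have dis := disjoint_embed gh F G.
  have -> : #|phi (F, G)| = (#|F| + #|G|)%N.
    rewrite /phi cardsU (eqP (_ : embed g F :&: embed h G == finset.set0)) ?cards0 ?subn0.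
      by rewrite (card_embed ltg) (card_embed lth).
    by rewrite setI_eq0.
  have bphi : bridges (phi (F, G)) by apply: bridges_union.
  (* Every edge of the union stays on one side of [A], so its ends have the same palette. *)
  have /(card_colourings bphi) : forall x y, (x, y) \in phi (F, G) ->
      palette n m (n + m) A x = palette n m (n + m) A y.
    move=> x y; rewrite in_setU => /orP[] /imsetP[e _ [-> ->]];
      by apply/setP => c; rewrite !inE ?gA ?(negPf (hA _)).
  rewrite (eq_bigl [predU embed g F & embed h G]) ?bigU //=; last by move=> e; rewrite !inE.
  rewrite big_imset /=; last by move=> ? ? _ _; apply: embed_pair_inj.
  rewrite big_imset /=; last by move=> ? ? _ _; apply: embed_pair_inj.
  rewrite (eq_bigr (fun=> n)); last by move=> e _; rewrite card_palette gA.
  rewrite [X in (_ * (_ * X) = _)%N](eq_bigr (fun=> m)); last first.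
    by move=> e _; rewrite card_palette (negPf (hA _)).
  rewrite !prod_nat_const.
  have -> : (\prod_v #|palette n m (n + m) A v| = n ^ n * m ^ m)%N.
    rewrite (bigID (mem A)) /=; congr (_ * _)%N.
      rewrite (eq_bigr (fun=> n)); last by move=> v vA; rewrite card_palette vA.
      by rewrite prod_nat_const cA.
    rewrite (eq_bigr (fun=> m)); last by move=> v vA; rewrite card_palette (negPf vA).
    rewrite prod_nat_const; congr (_ ^ _)%N; rewrite -[RHS]cAC.
    by apply: eq_card => v; rewrite !inE.
  move=> /(congr1 (fun k => k%:R : R)); rewrite !natrM !natrX => eqc.
  have nF : n%:R ^+ #|F| != 0 :> R by rewrite expf_neq0 // pnatr_eq0 -lt0n.
  have mG : m%:R ^+ #|G| != 0 :> R by rewrite expf_neq0 // pnatr_eq0 -lt0n.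
  rewrite mulrACA -eqc !expr_div_n exprD; field.
  by rewrite nF mG.
pose wt (F : {set 'I_(n + m) * 'I_(n + m)}) :=
  alpha ^+ #|F| * #|colourings F (palette n m (n + m) A)|%:R.
pose P := [pred FG | ok n FG.1 && ok m FG.2].
(* Terms are nonnegative, so restricting to the image of the injective map [phi] only lowers the
   sum. *)
apply: (@le_trans _ _ (\sum_(F in phi @: P) wt F)).
  by rewrite big_imset //= => ? ? _ _; apply: phi_inj.
rewrite [leRHS](bigID (mem (phi @: P))) /=.
rewrite [X in _ <= X + _](eq_bigl (mem (phi @: P))).
  by rewrite lerDl; apply: sumr_ge0 => F _; rewrite mulr_ge0 ?exprn_ge0.
move=> F /=; apply: andb_idl => /imsetP[[F1 F2]].
rewrite inE /= => /andP[/andP[s1 b1] /andP[s2 b2]] ->.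
by rewrite /phi /= subUset !embed_pairs //= bridges_union.
Qed.

(** The binomial coefficient counts the sets [A] of size [n], each of which gives one copy of the
    split bound. For a fixed forest, the colourings arising from all these [A] are distinct
    colourings with [n + m] colours. *)
Lemma forest_sum_supermultiplicative (R : realType) n m (alpha : R) :
  0 <= alpha -> (0 < n)%N -> (0 < m)%N ->
  'C(n + m, n)%:R * ((n%:R ^+ n * gsum n (alpha / n%:R) (@bridges n)) *
                     (m%:R ^+ m * gsum m (alpha / m%:R) (@bridges m))) <=
  (n + m)%:R ^+ (n + m) * gsum (n + m) (alpha / (n + m)%:R) (@bridges (n + m)).
Proof.
move=> alpha0 n0 m0.
have cC : #|{: 'I_n + 'I_m}| = (n + m)%N by rewrite card_sum !card_ord.
have := @forest_sum_colourings R (n + m) ('I_n + 'I_m)%type alpha.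
rewrite cC => ->; last by rewrite addn_gt0 n0.
pose ok (F : {set 'I_(n + m) * 'I_(n + m)}) := (F \subset pairs (n + m)) && bridges F.
apply: (@le_trans _ _ (\sum_(A : {set 'I_(n + m)} | #|A| == n) \sum_(F | ok F)
     alpha ^+ #|F| * #|colourings F (palette n m (n + m) A)|%:R)).
  rewrite -[n in 'C(_, n)]/n -{1}[(n + m)%N]card_ord -card_draws -sum1_card natr_sum mulr_suml.
  rewrite big_mkcond [leRHS]big_mkcond /=; apply: ler_sum => A _; rewrite inE.
  by case: eqP => // cA; rewrite mul1r forest_sum_split.
rewrite exchange_big /=; apply: ler_sum => F _.
rewrite -mulr_sumr ler_wpM2l ?exprn_ge0 // -natr_sum ler_nat.
apply: leq_trans (sum_colourings_palette n m F).
by rewrite big_mkcond /=; apply: leq_sum => A _; case: ifP.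
Qed.

(** * Bounding weighted sums by encodings *)

Section Covering.
Variables (R : realType) (T : finType) (q : R).
Hypothesis q0 : 0 <= q.

Lemma sum_subsets (M : {set T}) :
  \sum_(E : {set T} | E \subset M) q ^+ #|E| = (1 + q) ^+ #|M|.
Proof.
(* Expanding this product gives a sum over all sets, in which a set not inside [M] acquires a factor
   0. *)
transitivity (\prod_x ((if x \in M then q else 0) + 1)).
  rewrite bigA_distr /= [RHS](bigID (fun E : {set T} => E \subset M)) /=.
  rewrite [X in _ = _ + X]big1 ?addr0; last first.
    move=> E /subsetPn[x xE xM]; rewrite (bigD1 x) //= xE (negPf xM) mul0r //.
  apply: eq_bigr => E /subsetP sE; rewrite (bigID (mem E)) /= [X in _ = _ * X]big1 ?mulr1.
    rewrite (eq_bigr (fun=> q)) ?prodr_const // => x xE.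
    by rewrite xE sE.
  by move=> x /negPf ->.
rewrite (bigID (mem M)) /= [X in _ * X]big1 ?mulr1.
  rewrite (eq_bigr (fun=> 1 + q)) ?prodr_const // => x xM.
  by rewrite xM addrC.
by move=> x /negPf ->; rewrite add0r.
Qed.

(* Each [E] in [D] is encoded by an index [h E] together with the subset
   [E :\: base (h E)] of [M (h E)]. *)
Lemma sum_cover (I : finType) (D : pred {set T}) (J : pred I)
    (h : {set T} -> I) (base M : I -> {set T}) :
  (forall E, D E -> [/\ J (h E), base (h E) \subset E & E :\: base (h E) \subset M (h E)]) ->
  \sum_(E | D E) q ^+ #|E| <= \sum_(i | J i) q ^+ #|base i| * (1 + q) ^+ #|M i|.
Proof.
move=> hD; rewrite (partition_big h J) /=; last by move=> E /hD[].
apply: ler_sum => i Ji; rewrite -sum_subsets big_distrr /=.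
pose P E := D E && (h E == i); pose res E := E :\: base i.
(* All sets in the fibre of [h] over [i] contain [base i], so removing it is injective there and
   lowers the exponent by [#|base i|]. *)
have -> : \sum_(E | D E && (h E == i)) q ^+ #|E| =
    \sum_(E in res @: P) q ^+ #|base i| * q ^+ #|E|.
  rewrite big_imset /=; last first.
    move=> E E' /andP[/hD[_ b _] /eqP hE] /andP[/hD[_ b' _] /eqP hE'].
    rewrite hE in b; rewrite hE' in b' => eqE.
    by rewrite -(setID E (base i)) -(setID E' (base i)) (setIidPr b) (setIidPr b') -/(res E) eqE.
  apply: eq_bigr => E /andP[/hD[_ b _] /eqP hE]; rewrite hE in b.
  by rewrite -exprD -(cardsID (base i) E) (setIidPr b).
rewrite [leRHS](bigID (mem (res @: P))) /=.
rewrite [X in _ <= X + _](eq_bigl (mem (res @: P))).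
  by rewrite lerDl; apply: sumr_ge0 => E _; rewrite mulr_ge0 ?exprn_ge0.
move=> E /=; apply: andb_idl => /imsetP[E' /andP[/hD[_ _ s] /eqP hE] ->].
by rewrite /res -hE.
Qed.

End Covering.

Lemma expr1D_le_expR (R : realType) (x y : R) k :
  0 <= x -> k%:R <= y -> (1 + x) ^+ k <= expR (x * y).
Proof.
move=> x0 ky; apply: (@le_trans _ _ (expR (x * k%:R))).
  rewrite expRM_natr; apply: lerXn2r; rewrite ?nnegrE ?expR_ge0 ?expR_ge1Dx //.
  by rewrite addr_ge0.
by rewrite ler_expR ler_wpM2l.
Qed.

Lemma card_connected_pairs (R : realType) n (F : {set 'I_n * 'I_n}) (s : R) :
  eventB n s F ->
  #|[set e : 'I_n * 'I_n | connect (adj F) e.1 e.2]|%:R <= s * n%:R.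
Proof.
move=> /forallP Bs; rewrite -sum1_card.
rewrite (eq_bigl (fun e : 'I_n * 'I_n => true && connect (adj F) e.1 e.2)); last first.
  by move=> e; rewrite inE.
rewrite -(pair_big_dep xpredT (fun x y => connect (adj F) x y) (fun _ _ => 1%N)) /=.
rewrite natr_sum; apply: (@le_trans _ _ (\sum_(x < n) s)).
  apply: ler_sum => x _; apply: le_trans (Bs x); rewrite ler_nat sum1_card.
  by apply/subset_leq_card/subsetP => y; rewrite inE.
by rewrite sumr_const card_ord mulr_natr.
Qed.

Lemma gsum_eventB_le (R : realType) n (q s : R) : 0 <= q ->
  gsum n q (eventB n s) <= expR (q * (s * n%:R)) * gsum n q (@eventL n).
Proof.
move=> q0; have [h hP] := choice (fun E : {set 'I_n * 'I_n} =>
  let: ex_intro2 F bF sF := spanning_forest E in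
  ex_intro (fun F => bridges F /\ (F \subset E /\ connect (adj F) =2 connect (adj E)))
    F (conj bF sF)).
(* The code of [E] is its spanning forest, which has the same components and so stays in the event;
   the other edges of [E] lie inside these components. *)
pose J (F : {set 'I_n * 'I_n}) := [&& F \subset pairs n, bridges F & eventB n s F].
apply: le_trans (sum_cover q0 (J := J) (h := h) (base := id)
  (M := fun F => [set e | connect (adj F) e.1 e.2]) _) _.
  move=> E /andP[sE BE]; have [bF [sF cF]] := hP E; split => //.
    apply/and3P; split=> //; first exact: subset_trans sF sE.
    apply/forallP => v; apply: le_trans (forallP BE v).
    by rewrite ler_nat; apply/subset_leq_card/subsetP => u; rewrite !inE cF.
  apply/subsetP => -[x y]; rewrite !inE cF => /andP[_ xyE].
  by apply: connect1; rewrite /adj xyE.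
rewrite mulr_sumr big_mkcond [leRHS]big_mkcond /=; apply: ler_sum => F _.
rewrite /J; case: (boolP (F \subset pairs n)) => //= sF.
rewrite (eventL_bridges sF); case: (bridges F) => //=.
case: ifP => BF; last by rewrite mulr_ge0 ?expR_ge0 ?exprn_ge0.
rewrite mulrC ler_wpM2r ?exprn_ge0 // expr1D_le_expR //.
exact: card_connected_pairs.
Qed.

(** Exponential weighting: each counted set has [x ^+ #|S|] at least [x] to the power [n / r.+1],
    while the sum over all sets is [(1 + x) ^+ n]. *)
Lemma card_small_sets (R : realType) n r (x : R) : 0 < x <= 1 ->
  #|[set S : {set 'I_n} | (#|S| * r.+1 <= n)%N]|%:R <=
  expR (n%:R * (x - ln x / r.+1%:R)).
Proof.
move=> /andP[x0 x1].
have r0 : 0 < r.+1%:R :> R by rewrite ltr0n.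
have lnx0 : ln x <= 0 by rewrite ln_le0.
have H : #|[set S : {set 'I_n} | (#|S| * r.+1 <= n)%N]|%:R *
   expR (n%:R * (ln x / r.+1%:R)) <= expR (n%:R * x).
  apply: (@le_trans _ _ ((1 + x) ^+ #|[set: 'I_n]|)); last first.
    by rewrite cardsT card_ord mulrC expr1D_le_expR // ltW.
  rewrite -sum_subsets -sum1_card natr_sum mulr_suml big_mkcond [leRHS]big_mkcond /=.
  apply: ler_sum => S _; rewrite inE subsetT mul1r.
  case: ifP => cS; last by rewrite exprn_ge0 // ltW.
  have -> : x ^+ #|S| = expR (#|S|%:R * ln x) by rewrite expRM_natl lnK ?posrE.
  rewrite ler_expR mulrCA -subr_ge0.
  have -> : #|S|%:R * ln x - ln x * (n%:R / r.+1%:R) = - ln x * (n%:R / r.+1%:R - #|S|%:R) by ring.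
  apply: mulr_ge0; first by rewrite oppr_ge0.
  by rewrite subr_ge0 ler_pdivlMr // -natrM ler_nat.
rewrite mulrBr expRB ler_pdivlMr ?expR_gt0 //.
Qed.

(** A forest is encoded by a separator and its edges that miss it, with at most [2 * n ^ 2 / r.+1]
    pairs touching the separator. The part [x - ln x / r.+1] of the exponent pays for the choice of
    separator. *)
Lemma gsum_eventL_le (R : realType) n r (q x : R) : 0 <= q -> (0 < r)%N -> 0 < x <= 1 ->
  gsum n q (@eventL n) <=
  expR (n%:R * (x + (2 * (q * n%:R) - ln x) / r.+1%:R)) * gsum n q (eventB n (r%:R : R)).
Proof.
move=> q0 r0 x01.
have rp : 0 < r.+1%:R :> R by rewrite ltr0n.
pose good (S : {set 'I_n}) := (#|S| * r.+1 <= n)%N.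
(* The condition on [F] sits inside the existential so that [choice] gives a separator function on
   all edge sets. *)
have sepP (F : {set 'I_n * 'I_n}) : exists S : {set 'I_n},
    bridges F -> good S /\ forall v, (#|component (adj (F :\: touching S)) v| <= r)%N.
  have [bF|nbF] := boolP (bridges F); last by exists finset.set0.
  by have [S gS cS] := forest_separator bF r0; exists S.
have [sep hsep] := choice sepP.
pose J (i : {set 'I_n} * {set 'I_n * 'I_n}) :=
  good i.1 && ((i.2 \subset pairs n) && eventB n (r%:R : R) i.2).
apply: le_trans (sum_cover q0 (J := J) (h := fun F => (sep F, F :\: touching (sep F)))
  (base := fun i => i.2) (M := fun i => touching i.1) _) _.
  move=> F /andP[sF LF]; have /hsep[gS cS] : bridges F by rewrite -eventL_bridges.
  split => /=.
  - rewrite /J gS /= (subset_trans (subsetDl _ _) sF) /=.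
    by apply/forallP => v; rewrite ler_nat; apply: cS.
  - exact: subsetDl.
  - by rewrite setDDr setDv set0U subsetIr.
rewrite -(pair_big good (fun E : {set 'I_n * 'I_n} => (E \subset pairs n) && eventB n (r%:R : R) E)
  (fun S E => q ^+ #|E| * (1 + q) ^+ #|touching S|)) /=.
apply: (@le_trans _ _ (\sum_(S | good S)
    (expR (n%:R * (2 * (q * n%:R) / r.+1%:R)) * gsum n q (eventB n (r%:R : R))))).
  apply: ler_sum => S gS; rewrite mulr_sumr; apply: ler_sum => E _.
  rewrite mulrC ler_wpM2r ?exprn_ge0 //.
  have -> : n%:R * (2 * (q * n%:R) / r.+1%:R) = q * (2 * (n%:R / r.+1%:R) * n%:R) by ring.
  apply: expr1D_le_expR => //; apply: (@le_trans _ _ (2 * (#|S|%:R * n%:R))).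
    by rewrite -!natrM ler_nat card_touching.
  rewrite -mulrA ler_pM2l // ler_wpM2r // ler_pdivlMr // -natrM ler_nat //.
rewrite sumr_const -[leLHS]mulr_natl mulrA ler_wpM2r ?gsum_ge0 //.
have -> : n%:R * (x + (2 * (q * n%:R) - ln x) / r.+1%:R) =
  n%:R * (x - ln x / r.+1%:R) + n%:R * (2 * (q * n%:R) / r.+1%:R) by ring.
rewrite expRD ler_wpM2r ?expR_ge0 //; apply: le_trans (card_small_sets n r x01).
by rewrite ler_nat; apply/subset_leq_card/subsetP => S; rewrite !inE.
Qed.

Lemma Pgnp_gsum (R : realType) n (p : R) A : 0 <= p < 1 ->
  Pgnp n p A = (1 - p) ^+ #|pairs n| * gsum n (p / (1 - p)) A.
Proof.
move=> /andP[p0 p1]; rewrite /Pgnp mulr_sumr; apply: eq_bigr => E /andP[sE _].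
have np : 1 - p != 0 by rewrite gt_eqF // subr_gt0.
have cE := subset_leq_card sE.
rewrite expr_div_n mulrCA; congr (_ * _); rewrite -{2}(subnK cE) exprD mulfK //.
by rewrite expf_neq0.
Qed.

Lemma card_pairs (R : realType) n : #|pairs n|%:R = n%:R * (n%:R - 1) / 2 :> R.
Proof.
have -> : #|pairs n| = 'C(n, 2).
  rewrite -bin2_sum big_mkord -sum1_card.
  rewrite (eq_bigl (fun e : 'I_n * 'I_n => true && (e.1 < e.2)%N)); last first.
    by move=> e; rewrite inE.
  rewrite -(pair_big_dep xpredT (fun x y : 'I_n => (x < y)%N) (fun _ _ => 1%N)) /=.
  rewrite (exchange_big_dep xpredT) //=; apply: eq_bigr => y _.
  by rewrite (big_ord_narrow (ltnW (ltn_ord y))) sum_nat_const card_ord muln1.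
have := mul_bin_diag n 1; rewrite bin1 => /(congr1 (fun k => k%:R : R)).
case: n => [|n]; first by rewrite bin0n !mul0r.
rewrite /= !natrM => h; have {}h : n.+1%:R * n%:R = 2 * 'C(n.+1, 2)%:R :> R by rewrite h.
rewrite -[n.+1%:R - 1]/(n.+1%:R - 1%:R) -natrB // subn1 /= h.
by rewrite mulrAC divff ?mul1r // pnatr_eq0.
Qed.

(** * The weight of forests *)

Lemma gsum_ge1 (R : realType) n (q : R) : 0 <= q -> 1 <= gsum n q (@bridges n).
Proof.
move=> q0; rewrite /gsum (bigD1 finset.set0) /=; last first.
  by rewrite sub0set; apply/bridgesP => x y; rewrite inE.
by rewrite cards0 expr0 lerDl; apply: sumr_ge0 => F _; rewrite exprn_ge0.
Qed.

Lemma gsum0 (R : realType) n : gsum n (0 : R) (@bridges n) = 1.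
Proof.
rewrite /gsum (bigD1 finset.set0) /=; last first.
  by rewrite sub0set; apply/bridgesP => x y; rewrite inE.
rewrite cards0 expr0 big1 ?addr0 // => F /andP[_ F0].
by rewrite expr0n cards_eq0 (negPf F0).
Qed.

Lemma gsum_le_expR (R : realType) n (q : R) A : 0 <= q ->
  gsum n q A <= expR (q * (n%:R * n%:R)).
Proof.
move=> q0; apply: (@le_trans _ _ ((1 + q) ^+ #|pairs n|)); last first.
  apply: expr1D_le_expR => //; rewrite -natrM ler_nat.
  by rewrite (leq_trans (max_card _)) // card_prod card_ord.
rewrite -sum_subsets /gsum big_mkcond [leRHS]big_mkcond /=; apply: ler_sum => E _.
by case: (_ \subset _) => //=; case: ifP => // _; rewrite exprn_ge0.
Qed.

(** The weighted number of forests with [n] colours; dividing by the factorial absorbs the binomial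
    coefficient from splitting the vertices. *)
Definition forest_weight (R : realType) (alpha : R) n : R :=
  n%:R ^+ n / n`!%:R * gsum n (alpha / n%:R) (@bridges n).

Lemma natr_exp_fact_ge1 (R : realType) n : 1 <= n%:R ^+ n / n`!%:R :> R.
Proof.
rewrite ler_pdivlMr ?ltr0n ?fact_gt0 // mul1r -natrX ler_nat.
elim: n => // n IH; rewrite factS expnS leq_mul2l (leq_trans IH) ?orbT //.
by case: n {IH} => // n; rewrite leq_exp2r.
Qed.

Lemma forest_weight_ge1 (R : realType) (alpha : R) n : 0 <= alpha -> 1 <= forest_weight alpha n.
Proof.
move=> a0; apply: mulr_ege1; first exact: natr_exp_fact_ge1.
by apply: gsum_ge1; rewrite divr_ge0.
Qed.

Lemma forest_weightD (R : realType) (alpha : R) n m : 0 <= alpha -> (0 < n)%N -> (0 < m)%N ->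
  forest_weight alpha n * forest_weight alpha m <= forest_weight alpha (n + m).
Proof.
move=> a0 n0 m0; have := forest_sum_supermultiplicative a0 n0 m0.
rewrite /forest_weight; set x := gsum n _ _; set y := gsum m _ _; set z := gsum (n + m) _ _.
have /(congr1 (fun k => k%:R : R)) := bin_fact (leq_addr m n).
rewrite addKn !natrM => eqC.
have nf : n`!%:R != 0 :> R by rewrite pnatr_eq0 -lt0n fact_gt0.
have mf : m`!%:R != 0 :> R by rewrite pnatr_eq0 -lt0n fact_gt0.
have fp : 0 < (n + m)`!%:R :> R by rewrite ltr0n fact_gt0.
move=> H; rewrite [leRHS]mulrAC ler_pdivlMr //.
apply: le_trans H; rewrite -eqC le_eqVlt; apply/orP; left; apply/eqP.
by field; rewrite nf mf.
Qed.

Lemma forest_weight_le (R : realType) (alpha : R) n : 0 <= alpha -> (0 < n)%N ->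
  forest_weight alpha n <= expR ((1 + alpha) * n%:R).
Proof.
move=> a0 n0; rewrite mulrDl mul1r expRD; apply: ler_pM.
- by apply: le_trans (natr_exp_fact_ge1 _ _); rewrite ler01.
- by rewrite gsum_ge0 // divr_ge0.
(* The quotient of [n ^ n] by the factorial of [n] is one term of the exponential series at [n]. *)
- case: n n0 => // n _; apply: le_trans (expR_ge1Dxn n _); last by [].
  by rewrite lerDr.
- apply: le_trans (gsum_le_expR _ _) _; first by rewrite divr_ge0.
  by rewrite ler_expR mulrA divfK // pnatr_eq0 -lt0n.
Qed.

Lemma gsum_eventL (R : realType) n (q : R) : gsum n q (@eventL n) = gsum n q (@bridges n).
Proof.
apply: eq_bigl => F; have [sF|//] := boolP (F \subset pairs n).
exact: eventL_bridges.
Qed.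

(** * Comparing the probability of [L] with the forest sum *)

Lemma edge_probability_bounds (R : realType) (alpha : R) n :
  0 <= alpha -> (0 < n)%N -> 2 * alpha <= n%:R ->
  [/\ 0 <= alpha / n%:R, alpha / n%:R <= 1 / 2 & alpha / n%:R * n%:R = alpha].
Proof.
move=> a0 n0 an; have np : 0 < n%:R :> R by rewrite ltr0n.
split; first exact: divr_ge0.
  by rewrite ler_pdivrMr //; lra.
by rewrite divfK // gt_eqF.
Qed.

Lemma edge_odds_bounds (R : realType) (alpha : R) n (p := alpha / n%:R) :
  0 <= alpha -> (0 < n)%N -> 2 * alpha <= n%:R ->
  0 <= p / (1 - p) /\ p / (1 - p) * n%:R <= 2 * alpha.
Proof.
move=> a0 n0 an; have [] := edge_probability_bounds a0 n0 an.
rewrite -/p; move: p => p p0 ph pn; split; first by rewrite divr_ge0 //; lra.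
rewrite mulrAC pn ler_pdivrMr; last lra.
nra.
Qed.

(** The weight is [alpha / n] here, not the odds, so [1 - p] keeps the exponent [#|pairs n| - #|F|].
    The constant is [alpha / 2], from the [n - 1] in the number of pairs, plus [alpha], which bounds
    [p * #|F|] because a forest has at most [n] edges. *)
Lemma P_alpha_eventL_le (R : realType) (alpha : R) n :
  0 <= alpha -> (0 < n)%N -> 2 * alpha <= n%:R ->
  P_alpha n alpha (@eventL n) <=
  expR (- (alpha / 2) * n%:R + 3 / 2 * alpha) * gsum n (alpha / n%:R) (@bridges n).
Proof.
move=> a0 n0 an; have [] := edge_probability_bounds a0 n0 an.
rewrite -gsum_eventL /P_alpha; move: (alpha / n%:R) => p p0 ph pn.
rewrite /Pgnp mulr_sumr.
apply: ler_sum => F /andP[sF LF]; rewrite mulrC ler_wpM2r ?exprn_ge0 //.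
have cF : (#|F| <= n)%N by apply: card_bridges; rewrite -eventL_bridges.
apply: (@le_trans _ _ (expR (- p * (#|pairs n| - #|F|)%:R))).
  rewrite expRM_natr; apply: lerXn2r; rewrite ?nnegrE ?expR_ge0 ?expR_ge1Dx //.
  lra.
rewrite ler_expR natrB ?subset_leq_card // card_pairs.
have cF' : #|F|%:R <= n%:R :> R by rewrite ler_nat.
have -> : - p * (n%:R * (n%:R - 1) / 2 - #|F|%:R) =
  - (alpha / 2) * n%:R + alpha / 2 + p * #|F|%:R by rewrite -pn; field.
have : p * #|F|%:R <= alpha by rewrite -pn ler_wpM2l.
lra.
Qed.

Lemma P_alpha_eventL_ge (R : realType) (alpha : R) n :
  0 <= alpha -> (0 < n)%N -> 2 * alpha <= n%:R ->
  expR (- (alpha / 2) * n%:R - alpha ^+ 2) * gsum n (alpha / n%:R) (@bridges n) <=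
  P_alpha n alpha (@eventL n).
Proof.
move=> a0 n0 an; have [] := edge_probability_bounds a0 n0 an.
rewrite -gsum_eventL /P_alpha; move: (alpha / n%:R) => p p0 ph pn.
rewrite /Pgnp mulr_sumr.
apply: ler_sum => F /andP[sF LF]; rewrite mulrC ler_wpM2l ?exprn_ge0 //.
apply: (@le_trans _ _ ((1 - p) ^+ #|pairs n|)); last first.
  by apply: ler_wiXn2l; [lra | lra | exact: leq_subr].
(* The inverse of [1 - p] is [1 + p / (1 - p)], at most the exponential of [p / (1 - p)]. The term
   [alpha ^+ 2] pays for having [p / (1 - p)] in place of [p]. *)
apply: (@le_trans _ _ (expR (- (p / (1 - p)) * #|pairs n|%:R))); last first.
  rewrite expRM_natr; apply: lerXn2r; rewrite ?nnegrE ?expR_ge0 //; first lra.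
  rewrite expRN invf_ple ?posrE ?expR_gt0 //; last lra.
  apply: le_trans (expR_ge1Dx _); rewrite le_eqVlt; apply/orP; left; apply/eqP.
  by field; rewrite gt_eqF //; lra.
rewrite ler_expR card_pairs.
have -> : - (p / (1 - p)) * (n%:R * (n%:R - 1) / 2) = - (alpha * (n%:R - 1)) / (2 * (1 - p)).
  by rewrite -pn; field; rewrite gt_eqF //; lra.
rewrite ler_pdivlMr; last lra.
have h1 : alpha * p <= alpha / 2 by nra.
have h2 : alpha ^+ 2 * p <= alpha ^+ 2 / 2 by have := sqr_ge0 alpha; nra.
have -> : (- (alpha / 2) * n%:R - alpha ^+ 2) * (2 * (1 - p)) =
  - alpha * n%:R + alpha * (p * n%:R) - 2 * alpha ^+ 2 + 2 * (alpha ^+ 2 * p) by field.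
rewrite pn; nra.
Qed.

(** * Limits *)

Local Open Scope classical_set_scope.

Lemma superadditive_mul (R : realType) (u : nat -> R) k q s :
  (forall n, 0 <= u n) ->
  (forall n m, (0 < n)%N -> (0 < m)%N -> u n + u m <= u (n + m)%N) ->
  (0 < k)%N -> q%:R * u k <= u (q * k + s)%N.
Proof.
move=> u0 uD k0; elim: q => [|q IH]; first by rewrite mul0r.
rewrite mulSn -addnA -natr1 mulrDl mul1r addrC.
(* Superadditivity needs positive arguments; if the second summand is 0, then so is [q]. *)
have [e0|m0] := posnP (q * k + s)%N; last exact: le_trans (lerD _ IH) (uD _ _ k0 m0).
have q0 : q = 0%N.
  by move/eqP: e0; rewrite addn_eq0 muln_eq0 (gtn_eqF k0) orbF => /andP[/eqP].
by rewrite e0 addn0 q0 mul0r addr0.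
Qed.

(** Fekete's lemma; the limit is the supremum of the quotients. *)
Lemma superadditive_cvg (R : realType) (u : nat -> R) (c : R) :
  (forall n, 0 <= u n) ->
  (forall n m, (0 < n)%N -> (0 < m)%N -> u n + u m <= u (n + m)%N) ->
  (forall n, (0 < n)%N -> u n <= c * n%:R) ->
  exists l : R, (fun n => u n / n%:R) @ \oo --> l.
Proof.
move=> u0 uD uc; pose X := [set x | exists2 n, (0 < n)%N & x = u n / n%:R].
have ubX x : X x -> x <= c.
  by move=> [n n0 ->]; rewrite ler_pdivrMr ?ltr0n // uc.
have supX : has_sup X.
  by split; [exists (u 1%N / 1%:R); exists 1%N|exists c => x /ubX].
exists (sup X); apply/cvgrPdist_le => e e0.
have e20 : 0 < e / 2 by rewrite divr_gt0.
(* Take [k] with quotient within [e / 2] of the supremum. Dividing [n] by [k] with remainder loses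
   at most [u k], which is at most [e / 2 * n] for large [n]. *)
have [_ [k k0 ->] ltk] := sup_adherent e20 supX.
near=> n.
have n0 : (0 < n)%N by near: n; exists 1%N.
have nR : 0 < n%:R :> R by rewrite ltr0n.
have kR : 0 < k%:R :> R by rewrite ltr0n.
have le_sup : u n / n%:R <= sup X by apply: (sup_upper_bound supX); exists n.
rewrite ger0_norm ?subr_ge0 //.
have big : u k <= e / 2 * n%:R.
  have : u k / (e / 2) <= n%:R by near: n; exact: nbhs_infty_ger.
  by rewrite ler_pdivrMr // mulrC.
have := superadditive_mul (n %/ k)%N (n %% k)%N u0 uD k0.
rewrite -divn_eq => h.
have hdiv : n%:R <= ((n %/ k)%N%:R + 1) * k%:R :> R.
  rewrite {1}(divn_eq n k) natrD natrM mulrDl mul1r lerD2l ler_nat ltnW //.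
  by rewrite ltn_mod.
have h2 : u k / k%:R * n%:R - u k <= u n.
  apply: le_trans h; rewrite lerBlDr.
  apply: (@le_trans _ _ (u k / k%:R * (((n %/ k)%N%:R + 1) * k%:R))).
    by rewrite ler_wpM2l // divr_ge0.
  by rewrite mulrCA divfK ?gt_eqF // mulrDl mul1r.
have h3 : u k / k%:R - e / 2 <= u n / n%:R.
  rewrite ler_pdivlMr // mulrBl; lra.
lra.
Unshelve. all: by end_near. Qed.

Lemma ln_forest_weight_cvg (R : realType) (alpha : R) : 0 <= alpha ->
  exists l : R, (fun n => ln (forest_weight alpha n) / n%:R) @ \oo --> l.
Proof.
move=> a0.
have pos n : 0 < forest_weight alpha n.
  by apply: lt_le_trans (forest_weight_ge1 n a0); rewrite ltr01.
apply: (@superadditive_cvg _ _ (1 + alpha)).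
- by move=> n; rewrite ln_ge0 // forest_weight_ge1.
- move=> n m n0 m0; rewrite -lnM ?posrE // ler_ln ?posrE //.
    exact: forest_weightD.
  by apply: mulr_gt0.
- move=> n n0; rewrite -[leRHS]expRK ler_ln ?posrE ?expR_gt0 //.
  exact: forest_weight_le.
Qed.

(** At [alpha = 0] only the empty forest contributes, so [forest_weight 0 n] is the prefactor alone;
    dividing by it isolates the sum over forests. *)
Lemma ln_gsum_cvg (R : realType) (alpha : R) : 0 <= alpha ->
  exists l : R, (fun n => ln (gsum n (alpha / n%:R) (@bridges n)) / n%:R) @ \oo --> l.
Proof.
move=> a0; have [la cva] := ln_forest_weight_cvg a0.
have [lb cvb] := ln_forest_weight_cvg (lexx (0 : R)).
exists (la - lb).
have cv : (fun n => ln (forest_weight alpha n) / n%:R - ln (forest_weight 0 n) / n%:R)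
    @ \oo --> la - lb by apply: cvgB.
apply: cvg_trans cv; apply: near_eq_cvg.
near=> n; rewrite /= -mulrBl; congr (_ / _).
have g0 : 0 < gsum n (alpha / n%:R) (@bridges n).
  by apply: lt_le_trans (gsum_ge1 n (divr_ge0 a0 (ler0n _ n))); rewrite ltr01.
have w0 : 0 < forest_weight (0 : R) n.
  by apply: lt_le_trans (forest_weight_ge1 n (lexx (0 : R))); rewrite ltr01.
have -> : forest_weight alpha n = forest_weight 0 n * gsum n (alpha / n%:R) (@bridges n).
  by rewrite /forest_weight mul0r gsum0 mulr1.
by rewrite lnM ?posrE // addrC addKr.
Unshelve. all: by end_near. Qed.

Lemma near_large (R : realType) (alpha : R) :
  \forall n \near \oo, (0 < n)%N /\ 2 * alpha <= n%:R.
Proof.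
near=> n; split; first by near: n; exists 1%N.
by near: n; exact: nbhs_infty_ger.
Unshelve. all: by end_near. Qed.

Lemma P_alpha_eventL_gt0 (R : realType) (alpha : R) n :
  0 <= alpha -> (0 < n)%N -> 2 * alpha <= n%:R -> 0 < P_alpha n alpha (@eventL n).
Proof.
move=> a0 n0 an; apply: lt_le_trans (P_alpha_eventL_ge a0 n0 an).
rewrite mulr_gt0 ?expR_gt0 //.
by apply: lt_le_trans (gsum_ge1 n (divr_ge0 a0 (ler0n _ n))); rewrite ltr01.
Qed.

Lemma ln_eventL_cvg (R : realType) (alpha : R) : 0 <= alpha ->
  exists l : R, (fun n => ln (P_alpha n alpha (@eventL n)) / n%:R) @ \oo --> l.
Proof.
move=> a0; have [z cz] := ln_gsum_cvg a0.
pose zn n := ln (gsum n (alpha / n%:R) (@bridges n)) / n%:R.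
(* The two bounds on the probability of [L] differ by a constant in the exponent, which disappears
   after division by [n]. *)
have cinv (c : R) : (fun n : nat => - (alpha / 2) + zn n + c / n%:R) @ \oo --> - (alpha / 2) + z.
  rewrite -[X in _ --> X]addr0; apply: cvgD; first by apply: cvgD => //; apply: cvg_cst.
  apply/cvgrPdist_le => e e0; near=> n; rewrite sub0r normrN normrM normfV.
  have n0 : 0 < n%:R :> R by rewrite ltr0n; near: n; exists 1%N.
  rewrite (gtr0_norm n0) ler_pdivrMr // mulrC -ler_pdivrMr //.
  by near: n; exact: nbhs_infty_ger.
exists (- (alpha / 2) + z).
apply: squeeze_cvgr (cinv (- alpha ^+ 2)) (cinv (3 / 2 * alpha)).
near=> n.
have [n0 an] : (0 < n)%N /\ 2 * alpha <= n%:R by near: n; exact: near_large.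
have nR : 0 < n%:R :> R by rewrite ltr0n.
have g0 : 0 < gsum n (alpha / n%:R) (@bridges n).
  by apply: lt_le_trans (gsum_ge1 n (divr_ge0 a0 (ler0n _ n))); rewrite ltr01.
have P0 := P_alpha_eventL_gt0 a0 n0 an.
have E (c : R) : - (alpha / 2) + zn n + c / n%:R =
   ln (expR (- (alpha / 2) * n%:R + c) * gsum n (alpha / n%:R) (@bridges n)) / n%:R.
  rewrite lnM ?posrE ?expR_gt0 // expRK /zn; field.
  by rewrite gt_eqF.
rewrite !E !ler_pM2r ?invr_gt0 // !ler_ln ?posrE ?mulr_gt0 ?expR_gt0 //.
by rewrite P_alpha_eventL_le // P_alpha_eventL_ge.
Unshelve. all: by end_near. Qed.

(** Positivity of the limit lets multiplicative errors [expR d] be turned into additive ones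
    later. *)
Lemma powR_eventL_cvg (R : realType) (alpha : R) : 0 <= alpha ->
  exists2 l : R, 0 < l & (fun n => P_alpha n alpha (@eventL n) `^ n%:R^-1) @ \oo --> l.
Proof.
move=> a0; have [z cz] := ln_eventL_cvg a0; exists (expR z); first exact: expR_gt0.
apply: cvg_trans (cvg_comp _ _ cz (@continuous_expR R z)); apply: near_eq_cvg.
near=> n.
have [n0 an] : (0 < n)%N /\ 2 * alpha <= n%:R by near: n; exact: near_large.
by rewrite /= /powR gt_eqF ?P_alpha_eventL_gt0 // mulrC.
Unshelve. all: by end_near. Qed.

(** * Comparison of the events for large [n] *)

Lemma P_alpha_le (R : realType) (alpha : R) n (A B : pred {set 'I_n * 'I_n}) (c : R) :
  0 <= alpha -> (0 < n)%N -> 2 * alpha <= n%:R ->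
  (forall q : R, 0 <= q -> q * n%:R <= 2 * alpha -> gsum n q A <= c * gsum n q B) ->
  P_alpha n alpha A <= c * P_alpha n alpha B.
Proof.
move=> a0 n0 an AB; have [p0 ph _] := edge_probability_bounds a0 n0 an.
(* The odds satisfy [q * n <= 2 * alpha], which makes the later constants independent of [n]. *)
have [q0 qn] := edge_odds_bounds a0 n0 an.
have p01 : 0 <= alpha / n%:R < 1 by rewrite p0 /=; lra.
rewrite /P_alpha !Pgnp_gsum // mulrCA ler_wpM2l ?AB //.
by rewrite exprn_ge0 //; lra.
Qed.

Lemma P_alpha_ge0 (R : realType) (alpha : R) n (A : pred {set 'I_n * 'I_n}) :
  0 <= alpha -> (0 < n)%N -> 2 * alpha <= n%:R -> 0 <= P_alpha n alpha A.
Proof.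
move=> a0 n0 an; have [p0 ph _] := edge_probability_bounds a0 n0 an.
by apply: sumr_ge0 => E _; rewrite mulr_ge0 ?exprn_ge0 //; lra.
Qed.

Lemma powR_le_expR (R : realType) (x y d : R) n : (0 < n)%N -> 0 <= x -> 0 <= y ->
  x <= expR (n%:R * d) * y -> x `^ n%:R^-1 <= expR d * y `^ n%:R^-1.
Proof.
move=> n0 x0 y0 xy; have nR : 0 < n%:R :> R by rewrite ltr0n.
apply: le_trans (ge0_ler_powR _ _ _ xy) _; rewrite ?nnegrE ?mulr_ge0 ?expR_ge0 ?invr_ge0 //.
rewrite powRM ?expR_ge0 // -expRM mulrAC divff ?mul1r ?gt_eqF //.
Qed.

Lemma near_eventB_linear_le (R : realType) (alpha d : R) : 0 <= alpha -> 0 < d ->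
  exists2 eps0 : R, 0 < eps0 & forall eps : R, 0 < eps <= eps0 ->
    \forall n \near \oo, P_alpha n alpha (eventB n (eps * n%:R)) `^ n%:R^-1 <=
      expR d * P_alpha n alpha (@eventL n) `^ n%:R^-1.
Proof.
(* The exponent [q * eps * n ^ 2] is at most [2 * alpha * eps * n]; the added 1 keeps the
   denominator positive when [alpha = 0]. *)
move=> alpha0 d0; exists (d / (2 * alpha + 1)); first by rewrite divr_gt0 //; lra.
move=> eps /andP[eps0]; rewrite ler_pdivlMr; last lra.
move=> epsd; near=> n.
have [n0 an] : (0 < n)%N /\ 2 * alpha <= n%:R by near: n; exact: near_large.
apply: powR_le_expR; rewrite ?P_alpha_ge0 //.
apply: P_alpha_le => // q q0 qn; apply: le_trans (gsum_eventB_le n _ q0) _.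
rewrite ler_wpM2r ?gsum_ge0 // ler_expR.
have nR : 0 < n%:R :> R by rewrite ltr0n.
have -> : q * (eps * n%:R * n%:R) = n%:R * (eps * (q * n%:R)) by ring.
rewrite ler_pM2l //; nra.
Unshelve. all: by end_near. Qed.

Lemma near_eventL_le (R : realType) (alpha d : R) : 0 <= alpha -> 0 < d ->
  exists r0 : R, forall r, r0 <= r ->
    \forall n \near \oo, P_alpha n alpha (@eventL n) `^ n%:R^-1 <=
      expR d * P_alpha n alpha (eventB n r) `^ n%:R^-1.
Proof.
(* The budget [d] is halved: [x] takes one half, and [k] is so large that the quotient by [k.+1]
   takes at most the other. Here [4 * alpha] bounds [2 * (q * n)]. *)
move=> alpha0 d0; pose x : R := Num.min (d / 2) 1.
have x01 : 0 < x <= 1 by rewrite lt_min ge_min lexx orbT ltr01 divr_gt0.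
have lnx : ln x <= 0 by rewrite ln_le0 //; case/andP: x01.
pose k := (Num.truncn ((4 * alpha - ln x) / (d / 2))).+1.
have kP : (4 * alpha - ln x) / (d / 2) <= k.+1%:R.
  rewrite (le_trans (ltW (truncnS_gt _))) // ler_nat //.
exists k%:R => r kr; near=> n.
have [n0 an] : (0 < n)%N /\ 2 * alpha <= n%:R by near: n; exact: near_large.
apply: powR_le_expR; rewrite ?P_alpha_ge0 //.
apply: P_alpha_le => // q q0 qn.
have nR : 0 < n%:R :> R by rewrite ltr0n.
apply: le_trans (gsum_eventL_le n q0 (isT : (0 < k)%N) x01) _.
apply: ler_pM; rewrite ?expR_ge0 ?gsum_ge0 //.
  rewrite ler_expR ler_pM2l //.
  have xd : x <= d / 2 by rewrite ge_min lexx.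
  have : (2 * (q * n%:R) - ln x) / k.+1%:R <= d / 2.
    rewrite ler_pdivrMr ?ltr0n // [leRHS]mulrC -ler_pdivrMr ?divr_gt0 //.
    apply: le_trans kP; rewrite ler_pM2r ?invr_gt0 ?divr_gt0 //; lra.
  by move=> h; rewrite [leRHS]splitr lerD.
rewrite /gsum big_mkcond [leRHS]big_mkcond /=; apply: ler_sum => E _.
case: (E \subset pairs n) => //=; case: ifP => [/forallP BE|_].
  suff -> : eventB n r E by [].
  by apply/forallP => v; apply: le_trans kr.
by case: ifP => // _; rewrite exprn_ge0.
Unshelve. all: by end_near. Qed.

Lemma near_eventB_const_le (R : realType) (alpha r eps : R) : 0 <= alpha -> 0 < eps ->
  \forall n \near \oo, P_alpha n alpha (eventB n r) `^ n%:R^-1 <=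
    P_alpha n alpha (eventB n (eps * n%:R)) `^ n%:R^-1.
Proof.
move=> alpha0 eps0; near=> n.
have [n0 an] : (0 < n)%N /\ 2 * alpha <= n%:R by near: n; exact: near_large.
apply: ge0_ler_powR; rewrite ?nnegrE ?invr_ge0 ?P_alpha_ge0 //.
rewrite -[leRHS]mul1r; apply: P_alpha_le => // q q0 _; rewrite mul1r.
rewrite /gsum big_mkcond [leRHS]big_mkcond /=; apply: ler_sum => E _.
case: (E \subset pairs n) => //=; case: ifP => [/forallP BE|_].
  suff -> : eventB n (eps * n%:R) E by [].
  apply/forallP => v; apply: le_trans (BE v) _; rewrite mulrC -ler_pdivrMr //.
  by near: n; exact: nbhs_infty_ger.
by case: ifP => // _; rewrite exprn_ge0.
Unshelve. all: by end_near. Qed.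

(** * Upper and lower limits in the extended reals *)

Lemma le_limn_esup (R : realType) (u v : (\bar R)^nat) :
  (\forall n \near \oo, (u n <= v n)%E) -> (limn_esup u <= limn_esup v)%E.
Proof.
move=> uv; apply: le_ereal_inf_tmp => _ [V FV <-].
(* The upper limit is an infimum over the sets of the filter, so [V] may be shrunk to where the
   inequality holds. *)
apply: (@le_trans _ _ (ereal_sup [set u n | n in V `&` [set n | (u n <= v n)%E]])).
  apply: ereal_inf_lbound; exists (V `&` [set n | (u n <= v n)%E]) => //.
  exact: filterI.
apply: ge_ereal_sup => _ [n [Vn uvn] <-]; apply: le_trans uvn _.
by apply: ereal_sup_ubound; exists n.
Qed.

Lemma limn_esup_cst (R : realType) (c : \bar R) : limn_esup (fun=> c) = c.
Proof. by have [_ ->] := cvg_limn_einf_sup (cvg_cst c). Qed.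

Lemma limn_esup_le (R : realType) (u : (\bar R)^nat) (c : \bar R) :
  (\forall n \near \oo, (u n <= c)%E) -> (limn_esup u <= c)%E.
Proof. by move=> uc; rewrite -(limn_esup_cst c); apply: le_limn_esup. Qed.

Lemma limn_einf_ge (R : realType) (u : (\bar R)^nat) (c : \bar R) :
  (\forall n \near \oo, (c <= u n)%E) -> (c <= limn_einf u)%E.
Proof.
move=> cu; rewrite /limn_einf leeNr; apply: limn_esup_le.
by near do rewrite leeN2.
Unshelve. all: by end_near. Qed.

Lemma ereal_cvg_squeeze (R : realType) (T : Type) (F : set_system T) (f : T -> \bar R) (l : R) :
  Filter F ->
  (forall e : R, 0 < e -> \forall x \near F, ((l - e)%:E <= f x <= (l + e)%:E)%E) ->
  f @ F --> l%:E.
Proof.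
move=> FF h; apply: cvg_EFin.
  (* The case [e = 1] shows that the values are eventually finite. *)
  near=> x; have /andP[] : ((l - 1)%:E <= f x <= (l + 1)%:E)%E by near: x; exact: h.
  by case: (f x).
apply/cvgrPdist_le => e e0; near=> x.
have : ((l - e)%:E <= f x <= (l + e)%:E)%E by near: x; exact: h.
rewrite /=; case: (f x) => [y|/andP[]//|/andP[]//] /=; rewrite !lee_fin => /andP[h1 h2].
by rewrite ler_norml; lra.
Unshelve. all: by end_near. Qed.

Theorem theorem2p4 (R : realType) (alpha : R) (halpha : 0 <= alpha) :
  exists l : R,
    [/\ (fun r : R =>
           limn_einf (fun n => ((P_alpha n alpha (eventB n r)) `^ (n%:R^-1))%:E))
           @ +oo --> l%:E,
        (fun eps : R =>
           limn_esup (fun n => ((P_alpha n alpha (eventB n (eps * n%:R))) `^ (n%:R^-1))%:E))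
           @ 0^'+ --> l%:E
      & (fun n => ((P_alpha n alpha (@eventL n)) `^ (n%:R^-1))%:E) @ \oo --> l%:E].
Proof.
have [l l0 cl] := powR_eventL_cvg halpha; exists l.
(* One factor [expR d] is for the comparison of events, the other for the distance of the [n]-th
   root for [L] from its limit. *)
have delta (e : R) : 0 < e -> exists2 d : R, 0 < d & expR d * (expR d * l) <= l + e.
  move=> e0; exists (ln (1 + e / l) / 2).
    by rewrite divr_gt0 // ln_gt0 // ltrDl divr_gt0.
  rewrite mulrA -expRD -splitr lnK ?posrE ?addr_gt0 ?divr_gt0 //.
  by rewrite mulrDl mul1r divfK // gt_eqF.
have upper (e : R) : 0 < e -> exists2 eps0 : R, 0 < eps0 & forall eps : R, 0 < eps <= eps0 ->
  (limn_esup (fun n => (P_alpha n alpha (eventB n (eps * n%:R)) `^ (n%:R^-1))%:E) <= (l + e)%:E)%E.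
  move=> /delta[d d0 dl]; have [eps0 eps00 H] := near_eventB_linear_le halpha d0.
  exists eps0 => // eps /H{}H; apply: limn_esup_le; near=> n; rewrite lee_fin.
  apply: le_trans dl; apply: (@le_trans _ _ (expR d * P_alpha n alpha (@eventL n) `^ n%:R^-1)).
    by near: n.
  rewrite ler_pM2l ?expR_gt0 //; apply: ltW; near: n.
  by apply: (cvgr_lt l) => //; rewrite ltr_pMl // expR_gt1.
have lower (e : R) : 0 < e -> exists r0 : R, forall r, r0 <= r ->
  ((l - e)%:E <= limn_einf (fun n => (P_alpha n alpha (eventB n r) `^ (n%:R^-1))%:E))%E.
  move=> e0; have [d d0 dl] := delta e e0; have [r0 H] := near_eventL_le halpha d0.
  exists r0 => r /H{}H; apply: limn_einf_ge; near=> n; rewrite lee_fin.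
  have D0 := expR_gt0 d.
  rewrite -(ler_pM2l D0).
  apply: (@le_trans _ _ (P_alpha n alpha (@eventL n) `^ n%:R^-1)); last by near: n.
  apply: (@le_trans _ _ ((expR d)^-1 * l)).
    (* If [e <= l], the choice of [d] gives [expR d ^+ 2 * l * (l - e) <= (l + e) * (l - e) <= l ^+
       2]; otherwise [l - e] is negative. *)
    rewrite ler_pdivlMl // mulrA; nra.
  apply: ltW; near: n; apply: (cvgr_gt l) => //.
  by rewrite gtr_pMl // invf_lt1 ?expR_gt0 // expR_gt1.
(* For fixed [r] and [eps], [r <= eps * n] eventually. Hence [lower] and [upper] each bound both
   families, which squeezes them to the same limit. *)
have mono (r eps : R) : 0 < eps ->
  (limn_einf (fun n => (P_alpha n alpha (eventB n r) `^ (n%:R^-1))%:E) <=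
   limn_esup (fun n => (P_alpha n alpha (eventB n (eps * n%:R)) `^ (n%:R^-1))%:E))%E.
  move=> eps0; apply: le_trans (limn_einf_sup _) _; apply: le_limn_esup.
  near=> n; rewrite lee_fin; near: n; exact: (near_eventB_const_le r halpha eps0).
split.
- apply: ereal_cvg_squeeze => e e0; have [r0 Hr] := lower e e0.
  have [eps0 eps00 He] := upper e e0.
  near=> r; rewrite Hr /=; last by near: r; apply: nbhs_pinfty_ge; rewrite num_real.
  by apply: le_trans (mono r eps0 eps00) (He _ _); rewrite eps00 lexx.
- apply: ereal_cvg_squeeze => e e0; have [r0 Hr] := lower e e0.
  have [eps0 eps00 He] := upper e e0.
  near=> eps.
  have eps_gt0 : 0 < eps by near: eps; exact: nbhs_right_gt.
  rewrite (le_trans (Hr _ (lexx _)) (mono _ _ eps_gt0)) He // eps_gt0 /=.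
  by near: eps; exact: nbhs_right_le.
- by apply: cvg_EFin => //; near=> n.
Unshelve. all: by end_near. Qed.
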